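(* Let $G$ be a graph of order $n_0$ and size $m_0$, and let $k\ge 1$. Suppose $\mathcal{L}^k(G)$ has property $\varrho$ and the multiplicity of $-2$ as an eigenvalue of $\mathcal{L}^k(G)$ is $m_{k-1}-n_{k-1}$. Then $\mathcal{E}\big(Ebd(\mathcal{L}^k(G))\big)=2(3m_{k-1}-2n_{k-1})$. Consequently, the graphs $Ebd(\mathcal{L}^k(G))$ of all such graphs $G$ with the same $n_{k-1}$ and $m_{k-1}$ are mutually equienergetic.
   Context: $\mathcal{L}^k(G)$ is the $k$-th iterated line graph, of order $n_k$ and size $m_k$. Property $\varrho$: all negative adjacency eigenvalues equal $-2$. For a graph $X$ with vertices $v_1,\dots,v_N$, the extended bipartite double $Ebd(X)$ is the bipartite graph with parts $\{x_1,\dots,x_N\}$, $\{y_1,\dots,y_N\}$ in which $x_i\sim y_j$ iff $i=j$ or $v_iv_j\in E(X)$. Energy is the sum of absolute values of adjacency eigenvalues. *)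

(* Defs.v *)
From HB Require Import structures.
From mathcomp Require Import all_boot all_order all_algebra.

Set Implicit Arguments.
Unset Strict Implicit.
Unset Printing Implicit Defensive.

Import Order.TTheory GRing.Theory Num.Theory.
Local Open Scope ring_scope.

Record sgraph := SGraph {
  vertex :> finType;
  adj : rel vertex;
  adj_sym : symmetric adj;
  adj_irrefl : irreflexive adj
}.

Definition edges (G : sgraph) : {set {set G}} :=
  [set e | [exists x, exists y, adj x y && (e == [set x; y])]].

Definition gorder (G : sgraph) : nat := #|G|.
Definition gsize (G : sgraph) : nat := #|edges G|.

Section LineGraph.
Variable G : sgraph.

Definition edge_type : finType := {e : {set G} | e \in edges G}.

Definition line_adj : rel edge_type :=
  fun e f => (e != f) && (val e :&: val f != set0).

Fact line_adj_sym : symmetric line_adj.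
Proof. by move=> e f; rewrite /line_adj eq_sym setIC. Qed.

Fact line_adj_irrefl : irreflexive line_adj.
Proof. by move=> e; rewrite /line_adj eqxx. Qed.

Definition line_graph : sgraph := SGraph line_adj_sym line_adj_irrefl.

End LineGraph.

Definition iter_line_graph (k : nat) (G : sgraph) : sgraph :=
  iter k line_graph G.

Section ExtendedBipartiteDouble.
Variable X : sgraph.

Definition ebd_adj : rel (X + X)%type := fun u v =>
  match u, v with
  | inl x, inr y | inr y, inl x => (x == y) || adj x y
  | _, _ => false
  end.

Fact ebd_adj_sym : symmetric ebd_adj.
Proof. by move=> [x|x] [y|y]. Qed.

Fact ebd_adj_irrefl : irreflexive ebd_adj.
Proof. by case. Qed.

Definition ebd : sgraph := SGraph ebd_adj_sym ebd_adj_irrefl.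

End ExtendedBipartiteDouble.

Section Spectrum.
Variable C : numClosedFieldType.

Definition adj_mx (G : sgraph) : 'M[C]_#|G| :=
  \matrix_(i, j) (adj (enum_val i) (enum_val j))%:R.

(* The eigenvalues of G listed with algebraic multiplicity, in an unspecified
   order: the roots of the characteristic polynomial in the algebraically
   closed field C. *)
Definition spectrum (G : sgraph) : seq C :=
  sval (closed_field_poly_normal (char_poly (adj_mx G))).

Lemma char_poly_spectrum (G : sgraph) :
  char_poly (adj_mx G) = \prod_(z <- spectrum G) ('X - z%:P).
Proof.
rewrite /spectrum; case: closed_field_poly_normal => s /= {1}->.
by rewrite (monicP (char_poly_monic _)) scale1r.
Qed.

Lemma mem_spectrum (G : sgraph) (z : C) :
  (z \in spectrum G) = eigenvalue (adj_mx G) z.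
Proof. by rewrite eigenvalue_root_char char_poly_spectrum root_prod_XsubC. Qed.

Definition eig_mult (G : sgraph) (z : C) : nat := count_mem z (spectrum G).

(* The order on C is partial: z < 0 means that z is a negative real. *)
Definition property_rho (G : sgraph) : Prop :=
  forall z : C, eigenvalue (adj_mx G) z -> z < 0 -> z = -2.

Definition energy (G : sgraph) : C := \sum_(z <- spectrum G) `|z|.

(* Following the usual convention, equienergetic graphs have the same order. *)
Definition equienergetic (G H : sgraph) : Prop :=
  gorder G = gorder H /\ energy G = energy H.

End Spectrum.

(* Main.v *)
Require Import Defs.
From HB Require Import structures.
From mathcomp Require Import all_boot all_order all_algebra all_fingroup.
From mathcomp Require Import ring.

Set Implicit Arguments.
Unset Strict Implicit.
Unset Printing Implicit Defensive.

Import Order.TTheory GRing.Theory Num.Theory.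
Local Open Scope ring_scope.

(** The eigenvalues of [ebd X] are [z + 1] and [- (z + 1)] for the eigenvalues
    [z] of [X], because its adjacency matrix is [[0, A + I], [A + I, 0]].  Hence
    its energy is twice the sum of [`|z + 1|].  Under property rho each term is
    [z + 1], except that it is [(z + 1) + 2] when [z = -2].  Since the trace of
    [A] vanishes, the energy is [2 * (N + 2 * mult(-2))] with [N] the order of
    [X]; for an iterated line graph, [N] is the size of the previous iterate. *)

(** Between ordinals of equal size, [f] is a permutation; applied to both rows and columns, it
    contributes its sign twice. This frees determinants from the chosen enumeration of the
    vertices. *)
Lemma det_mxsub_inj (R : comPzRingType) (m n : nat) (f : 'I_m -> 'I_n)
    (A : 'M[R]_n) :
  m = n -> injective f -> \det (mxsub f f A) = \det A.
Proof.
move=> eq_mn; case: n / eq_mn in f A * => injf.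
have -> : mxsub f f A = row_perm (perm injf) (col_perm (perm injf) A).
  by apply/matrixP=> i j; rewrite !mxE !permE.
rewrite row_permE col_permE !det_mulmx !det_perm odd_permV mulrCA.
by rewrite -signr_addb addbb mulr1.
Qed.

Lemma char_poly_mxsub_inj (R : comNzRingType) (m n : nat) (f : 'I_m -> 'I_n)
    (A : 'M[R]_n) :
  m = n -> injective f -> char_poly (mxsub f f A) = char_poly A.
Proof.
move=> eq_mn injf; rewrite [RHS]/char_poly -(det_mxsub_inj _ eq_mn injf).
by congr (\det _); apply/matrixP=> i j; rewrite !mxE (inj_eq injf).
Qed.

(** Conjugation by a unitriangular block matrix turns the matrix into an upper triangular one with
    diagonal blocks [A + B] and [A - B]. *)
Lemma det_block_sym (R : comNzRingType) (n : nat) (A B : 'M[R]_n) :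
  \det (block_mx A B B A) = \det (A + B) * \det (A - B).
Proof.
transitivity (\det (block_mx 1%:M 0 (- 1%:M) 1%:M *m block_mx A B B A
                    *m block_mx 1%:M 0 1%:M 1%:M)).
  by rewrite !det_mulmx !det_lblock !det1 !mul1r !mulr1.
rewrite !mulmx_block !mul1mx !mul0mx !mulmx1 !mulmx0 !mulNmx !mul1mx !addr0.
have -> : - A + B + (- B + A) = 0 by rewrite addrC addrA addrK addNr.
by rewrite !add0r det_ublock [X in _ * \det X]addrC.
Qed.

Lemma char_poly_block_antidiag (R : comNzRingType) (n : nat) (B : 'M[R]_n) :
  char_poly (block_mx 0 B B 0) = char_poly B * char_poly (- B).
Proof.
rewrite /char_poly /char_poly_mx scalar_mx_block map_block_mx opp_block_mx.
by rewrite add_block_mx map_mx0 oppr0 addr0 !add0r det_block_sym map_mxN.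
Qed.

Lemma size_char_poly_roots (R : idomainType) (n : nat) (A : 'M[R]_n) (s : seq R) :
  char_poly A = \prod_(z <- s) ('X - z%:P) -> size s = n.
Proof.
by move=> cA; apply/eqP; rewrite -eqSS -(size_prod_XsubC _ id) -cA size_char_poly.
Qed.

(** Substituting [- 'X] for ['X] in ['X - A] gives [- ('X + A)]. The resulting sign [(-1) ^+ n] is
    shared out among the [n] linear factors, one [-1] each. *)
Lemma char_polyN_roots (R : idomainType) (n : nat) (A : 'M[R]_n) (s : seq R) :
  char_poly A = \prod_(z <- s) ('X - z%:P) ->
  char_poly (- A) = \prod_(z <- s) ('X - (- z)%:P).
Proof.
move=> cA; have sz := size_char_poly_roots cA.
rewrite /char_poly.
have -> : char_poly_mx (- A)
    = (-1) *: map_mx (comp_poly (- 'X)) (char_poly_mx A).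
  apply/matrixP=> i j; rewrite !mxE comp_polyB comp_polyC rmorphN.
  by rewrite rmorphMn /= comp_polyX mulNrn; ring.
rewrite detZ det_map_mx -/(char_poly A) cA rmorph_prod -sz /=.
elim: s {cA sz} => [|z s IH]; first by rewrite !big_nil mulr1.
rewrite !big_cons -IH exprS comp_polyB comp_polyX comp_polyC rmorphN /=.
ring.
Qed.

(** Composition with ['X - 1] is a ring morphism, so it commutes with the determinant. *)
Lemma char_polyD1_roots (R : idomainType) (n : nat) (A : 'M[R]_n) (s : seq R) :
  char_poly A = \prod_(z <- s) ('X - z%:P) ->
  char_poly (A + 1%:M) = \prod_(z <- s) ('X - (z + 1)%:P).
Proof.
move=> cA; rewrite /char_poly.
have -> : char_poly_mx (A + 1%:M)
    = map_mx (comp_poly ('X - 1)) (char_poly_mx A).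
  apply/matrixP=> i j; rewrite !mxE comp_polyB comp_polyC rmorphMn /=.
  by rewrite comp_polyX rmorphD rmorphMn /= mulrnBl; ring.
rewrite det_map_mx -/(char_poly A) cA rmorph_prod; apply: eq_bigr => z _.
by rewrite /= comp_polyB comp_polyX comp_polyC rmorphD /=; ring.
Qed.

Lemma sum_char_poly_roots (R : idomainType) (n : nat) (A : 'M[R]_n) (s : seq R) :
  char_poly A = \prod_(z <- s) ('X - z%:P) -> \sum_(z <- s) z = \tr A.
Proof.
move=> cA; have sz := size_char_poly_roots cA.
case: n A cA sz => [|n] A cA sz.
  by rewrite (size0nil sz) big_nil /mxtrace big_ord0.
apply: oppr_inj; rewrite -char_poly_trace // cA -[n]/(n.+1.-1) -sz coefPn_prod_XsubC //.
by rewrite sz.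
Qed.

(** For an eigenvector [v] with conjugate transpose [w], evaluating [v *m A *m w] in two ways gives
    [a] and its conjugate times the same scalar, the sum of the squared moduli of the entries of
    [v], which is nonzero. *)
Lemma real_sym_eigenvalue (C : numClosedFieldType) (n : nat) (A : 'M[C]_n)
    (a : C) :
  A^T = A -> map_mx Num.conj A = A -> eigenvalue A a -> a \is Num.real.
Proof.
move=> symA realA /eigenvalueP[v vA v0].
pose w := (map_mx Num.conj v)^T.
have Aw : A *m w = a^* *: w.
  by rewrite /w -{1}symA -trmx_mul -[in LHS]realA -map_mxM vA map_mxZ linearZ.
have vw0 : (v *m w) 0 0 != 0.
  apply: contraNneq v0; rewrite mxE => /eqP.
  rewrite psumr_eq0 => [/allP vw0|i _]; last by rewrite !mxE -normCK exprn_ge0.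
  apply/eqP/rowP=> i; apply/eqP; rewrite mxE.
  by move: (vw0 i (mem_index_enum i)); rewrite !mxE -normCK sqrf_eq0 normr_eq0.
apply/CrealP/(mulIf vw0).
have /matrixP/(_ 0 0) : v *m A *m w = v *m (A *m w) by rewrite mulmxA.
by rewrite vA Aw -scalemxAl -scalemxAr mxE [RHS]mxE => ->.
Qed.

Section Spectra.
Variable C : numClosedFieldType.

Lemma size_spectrum (X : sgraph) : size (spectrum C X) = gorder X.
Proof. exact: size_char_poly_roots (char_poly_spectrum C X). Qed.

Lemma sum_spectrum (X : sgraph) : \sum_(z <- spectrum C X) z = 0.
Proof.
rewrite (sum_char_poly_roots (char_poly_spectrum C X)).
by rewrite /mxtrace big1 // => i _; rewrite mxE adj_irrefl.
Qed.

Lemma spectrum_real (X : sgraph) (z : C) : z \in spectrum C X -> z \is Num.real.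
Proof.
rewrite mem_spectrum; apply: real_sym_eigenvalue; apply/matrixP=> i j.
  by rewrite !mxE adj_sym.
by rewrite !mxE rmorph_nat.
Qed.

Lemma char_poly_ebd (X : sgraph) :
  char_poly (adj_mx C (ebd X)) =
  char_poly (adj_mx C X + 1%:M) * char_poly (- (adj_mx C X + 1%:M)).
Proof.
(* [h] lists all left copies before all right copies; reindexing along it exposes the block form of
   the adjacency matrix. *)
pose h (i : 'I_(#|X| + #|X|)) : ebd X :=
  match split i with inl a => inl (enum_val a) | inr a => inr (enum_val a) end.
pose f i := enum_rank (h i).
have injf : injective f.
  move=> i j /enum_rank_inj; rewrite /h.
  by case: split_ordP => a ->; case: split_ordP => b -> // [] /enum_val_inj ->.
rewrite -(char_poly_mxsub_inj _ _ injf) ?card_sum // -char_poly_block_antidiag.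
congr char_poly; apply/matrixP=> i j; rewrite !mxE !enum_rankK /h.
case: (split i) => a; rewrite !mxE; case: (split j) => b;
  rewrite ?mxE //= (inj_eq enum_val_inj).
(* The disjunction in [ebd_adj] becomes a sum of indicators, since no vertex is adjacent to
   itself. *)
- by case: eqP => [->|_]; rewrite ?adj_irrefl ?add0r ?addr0.
- rewrite eq_sym adj_sym.
  by case: eqP => [->|_]; rewrite ?adj_irrefl ?add0r ?addr0.
Qed.

Lemma energy_ebd (X : sgraph) :
  energy C (ebd X) = 2 * \sum_(z <- spectrum C X) `|z + 1|.
Proof.
have cB := char_polyD1_roots (char_poly_spectrum C X).
have cB' : char_poly (adj_mx C X + 1%:M) =
    \prod_(z <- [seq z + 1 | z <- spectrum C X]) ('X - z%:P).
  by rewrite cB big_map.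
(* A product of monic linear factors determines its roots up to order. *)
have /prod_XsubC_eq perm_spec : \prod_(z <- spectrum C (ebd X)) ('X - z%:P) =
    \prod_(z <- [seq z + 1 | z <- spectrum C X]
             ++ [seq - (z + 1) | z <- spectrum C X]) ('X - z%:P).
  rewrite -char_poly_spectrum char_poly_ebd (char_polyN_roots cB') cB'.
  by rewrite big_cat !big_map.
rewrite /energy (perm_big _ perm_spec) big_cat !big_map /=.
by under [X in _ + X]eq_bigr do rewrite normrN; ring.
Qed.

Lemma energy_ebd_rho (X : sgraph) : property_rho C X ->
  energy C (ebd X) = 2 * ((gorder X)%:R + 2 * (eig_mult X (-2 : C))%:R).
Proof.
move=> rhoX; rewrite energy_ebd; congr (2 * _).
have -> : \sum_(z <- spectrum C X) `|z + 1| =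
    \sum_(z <- spectrum C X) (z + 1 + 2 * (z == -2)%:R).
  apply: eq_big_seq => z zX; have [->|z_neq] := eqVneq z (-2).
    by rewrite (_ : -2 + 1 = -1) ?normrN1 ?mulr1; ring.
  rewrite mulr0 addr0 ger0_norm // addr_ge0 //.
  (* The order on [C] is partial; realness of [z] is what allows the split by sign. *)
  case/orP: (spectrum_real zX) => // z_le0.
  move: z_le0; rewrite le_eqVlt => /orP[/eqP->//|z_lt0].
  by case/eqP: z_neq; apply: rhoX z_lt0; rewrite -mem_spectrum.
rewrite !big_split /= sum_spectrum add0r big_const_seq count_predT iter_addr_0.
rewrite size_spectrum -mulr_sumr -natr_sum; congr (_ + _ * _%:R).
rewrite /eig_mult -sum1_count [RHS]big_mkcond; apply: eq_bigr => z _ /=.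
by case: eqP.
Qed.

End Spectra.

Lemma gorder_line_graph (G : sgraph) : gorder (line_graph G) = gsize G.
Proof. exact: card_sig. Qed.

Lemma gorder_ebd (X : sgraph) : gorder (ebd X) = (gorder X + gorder X)%N.
Proof. exact: card_sum. Qed.

Theorem theorem6p1 (C : numClosedFieldType) (k : nat) (hk : (1 <= k)%N) :
  (forall G : sgraph,
     property_rho C (iter_line_graph k G) ->
     (eig_mult (iter_line_graph k G) (-2 : C))%:Z =
       (gsize (iter_line_graph (k - 1) G))%:Z
       - (gorder (iter_line_graph (k - 1) G))%:Z ->
     energy C (ebd (iter_line_graph k G)) =
       2 * (3 * (gsize (iter_line_graph (k - 1) G))%:R
            - 2 * (gorder (iter_line_graph (k - 1) G))%:R))
  /\
  (forall G H : sgraph,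
     property_rho C (iter_line_graph k G) ->
     (eig_mult (iter_line_graph k G) (-2 : C))%:Z =
       (gsize (iter_line_graph (k - 1) G))%:Z
       - (gorder (iter_line_graph (k - 1) G))%:Z ->
     property_rho C (iter_line_graph k H) ->
     (eig_mult (iter_line_graph k H) (-2 : C))%:Z =
       (gsize (iter_line_graph (k - 1) H))%:Z
       - (gorder (iter_line_graph (k - 1) H))%:Z ->
     gorder (iter_line_graph (k - 1) G) = gorder (iter_line_graph (k - 1) H) ->
     gsize (iter_line_graph (k - 1) G) = gsize (iter_line_graph (k - 1) H) ->
     equienergetic C (ebd (iter_line_graph k G)) (ebd (iter_line_graph k H))).
Proof.
case: k hk => // k _; rewrite subn1 /=.
have energyE (G : sgraph) : property_rho C (iter_line_graph k.+1 G) ->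
    (eig_mult (iter_line_graph k.+1 G) (-2 : C))%:Z =
      (gsize (iter_line_graph k G))%:Z - (gorder (iter_line_graph k G))%:Z ->
    energy C (ebd (iter_line_graph k.+1 G)) =
      2 * (3 * (gsize (iter_line_graph k G))%:R
           - 2 * (gorder (iter_line_graph k G))%:R).
  (* The multiplicity identity is carried from the integers to [C]. With [m] and [n] the size and
     order of the previous iterate, [m + 2 * (m - n)] is [3 * m - 2 * n]. *)
  move=> rhoG /(congr1 (fun m : int => m%:~R : C)); rewrite rmorphB /= => multE.
  rewrite energy_ebd_rho // -[(eig_mult _ _)%:R]/((eig_mult _ _)%:Z%:~R) multE.
  by rewrite gorder_line_graph; ring.
split=> // G H rhoG multG rhoH multH eq_n eq_m; split; last first.
  by rewrite !energyE // eq_n eq_m.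
by rewrite !gorder_ebd /= !gorder_line_graph eq_m.
Qed.
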